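(* Let $(P_{c,r},P_{c,d})$ be a fixed candidate pair such that the optimization problem $$\text{(P)}\quad \max_{\pmb{P}_p,\pmb{C}}\; R_c+\sum_{u=1}^{U}\bar R_{p,u}(P_{p,u})\quad\text{s.t.}\quad C_u+\bar R_{p,u}(P_{p,u})\ge R^{\mathrm{th}}\ \forall u,\quad \sum_{u}C_u=R_c,\quad \sum_u P_{p,u}=P_p,\quad C_u\ge 0,\ P_{p,u}\ge 0\ \forall u,$$ over $\pmb{P}_p=(P_{p,1},\ldots,P_{p,U})$ and $\pmb{C}=(C_1,\ldots,C_U)$, is feasible, and suppose $0\le R_c<UR^{\mathrm{th}}$. Let $(\pi_1,\ldots,\pi_U)$ be a permutation of $\{1,\ldots,U\}$ such that $\lambda_{\pi_1}\le\lambda_{\pi_2}\le\cdots\le\lambda_{\pi_U}$. Then an optimal common-rate allocation for (P) is given by $$C_{\pi_j}^{\star}=\min\big\{R^{\mathrm{th}},\,[R_c-(j-1)R^{\mathrm{th}}]^+\big\},\qquad j=1,\ldots,U,$$ where $[x]^+=\max\{x,0\}$, and the corresponding optimal private-power allocation is given by $$P_{p,\pi_j}^{\star}=P_{p,\pi_j}^{\min}(C_{\pi_j}^{\star}),\quad j=1,\ldots,U-1,\qquad P_{p,\pi_U}^{\star}=P_p-\sum_{j=1}^{U-1}P_{p,\pi_j}^{\min}(C_{\pi_j}^{\star}).$$ That is, $(\pmb{P}_p^\star,\pmb{C}^\star)$ is an optimal solution of (P).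
   Context: Users are indexed by $u\in\mathcal U=\{1,\ldots,U\}$. Given data: grid sizes $M,N\ge 1$; integers $l_{\max},k_{\max}\ge 0$; number of paths $Q\ge 1$; for each user $u$ and path $q$, an integer delay index $0\le l_{u,q}\le l_{\max}$, an integer Doppler index $|k_{u,q}|\le k_{\max}$ and a variance $\sigma_{u,q}^2>0$; $\sigma_u^2=\sum_{q}\sigma_{u,q}^2$; noise variance $\sigma_n^2>0$; power budget $P_{\max}>0$; rate threshold $R^{\mathrm{th}}\ge 0$. The delay-Doppler grid is $\{0,\ldots,M-1\}\times\{0,\ldots,N-1\}$. The pilot position is $(l_r,k_r)$; the guard positions are the points $(l,k)\ne(l_r,k_r)$ with $|l-l_r|\le l_{\max}$, $|k-k_r|\le 2k_{\max}$ (this rectangle is assumed to lie in the grid); all other grid points are data positions, forming the set $\mathcal A_{\mathrm{data}}$. The number of data positions is $N_c=MN-(4k_{\max}+1)(2l_{\max}+1)$, assumed $\ge 1$. $P_{c,r}\ge 0$ (pilot power) and $P_{c,d}\ge 0$ (common-data power) are fixed, and the total private-message power is $P_p=(MNP_{\max}-P_{c,r}-N_cP_{c,d})/(MN)$, assumed $\ge 0$. Set $\tilde\sigma_{n,u}^2=P_p\sigma_u^2+\sigma_n^2$, $$(\sigma_{u,q}^{\mathrm{err}})^2=\frac{\tilde\sigma_{n,u}^2\sigma_{u,q}^2}{P_{c,r}\sigma_{u,q}^2+\tilde\sigma_{n,u}^2},\qquad T_u=\sum_{q=1}^{Q}(\sigma_{u,q}^{\mathrm{err}})^2,\qquad \kappa_u=\sigma_u^2-T_u,$$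 $$\eta_u=P_{c,d}T_u+\sigma_u^2P_p+\sigma_n^2,\qquad \lambda_u=\kappa_u/\eta_u .$$ The private rate (lower bound) of user $u$ is $\bar R_{p,u}(P_{p,u})=\frac{N_c}{MN}\log_2\frac{\eta_u}{\eta_u-\kappa_uP_{p,u}}$. The allocable common rate is $R_c=\min_u R^{s}_{c,u}$, where, writing $s_{u,q}(l,k)=((l-l_{u,q})\bmod M,\,(k-k_{u,q})\bmod N)$ and letting $P_c(\cdot)$ equal $P_{c,r}$ at the pilot position, $0$ at guard positions and $P_{c,d}$ at data positions, $$R^{s}_{c,u}=\frac{1}{MN}\sum_{l=0}^{M-1}\sum_{k=0}^{N-1}\log_2\!\left(1+\frac{P_{c,d}\sum_{q:\,s_{u,q}(l,k)\in\mathcal A_{\mathrm{data}}}\big(\sigma_{u,q}^2-(\sigma_{u,q}^{\mathrm{err}})^2\big)}{\sum_{q=1}^{Q}(\sigma_{u,q}^{\mathrm{err}})^2P_c(s_{u,q}(l,k))+\sigma_u^2P_p+\sigma_n^2}\right).$$ For fixed $(P_{c,r},P_{c,d})$, all of $P_p$, $R_c$, $\kappa_u,\eta_u,\lambda_u$ are constants in (P). For $0\le C_u\le R^{\mathrm{th}}$ (and $\lambda_u>0$), the minimum private-message power with which user $u$ meets the threshold is $P_{p,u}^{\min}(C_u)=\frac{1-\phi_u(C_u)}{\lambda_u}$ with $\phi_u(C_u)=2^{-MN(R^{\mathrm{th}}-C_u)/N_c}$. *)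

(* Defs.v *)
From HB Require Import structures.
From mathcomp Require Import all_boot all_order all_algebra all_fingroup.
From mathcomp Require Import reals exp.
Set Implicit Arguments.
Unset Strict Implicit.
Unset Printing Implicit Defensive.
Import Order.TTheory GRing.Theory Num.Theory.
Local Open Scope ring_scope.

Definition log2 (R : realType) (x : R) : R := ln x / ln 2.

(* Users and paths are 0-indexed; pathvar is the variance sigma_{u,q}^2 itself,
   noise_var is sigma_n^2.  Nc is computed with truncated subtraction, which is
   exact because Nc >= 1 is required. *)
Record system (R : realType) := System {
  nusers : nat;
  npaths : nat;
  gridM : nat;
  gridN : nat;
  lmax : nat;
  kmax : nat;
  pilot_l : nat;
  pilot_k : nat;
  delay : 'I_nusers -> 'I_npaths -> nat;
  doppler : 'I_nusers -> 'I_npaths -> int;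
  pathvar : 'I_nusers -> 'I_npaths -> R;
  noise_var : R;
  Pmax : R;
  Rth : R;
  Nc : nat := (gridM * gridN - (4 * kmax + 1) * (2 * lmax + 1))%N;
  nusers_gt0 : (0 < nusers)%N;
  npaths_gt0 : (0 < npaths)%N;
  gridM_gt0 : (0 < gridM)%N;
  gridN_gt0 : (0 < gridN)%N;
  delay_le : forall u q, (delay u q <= lmax)%N;
  doppler_le : forall u q, (`|doppler u q| <= kmax)%N;
  pathvar_gt0 : forall u q, 0 < pathvar u q;
  noise_var_gt0 : 0 < noise_var;
  Pmax_gt0 : 0 < Pmax;
  Rth_ge0 : 0 <= Rth;
  guard_l_in_grid : (lmax <= pilot_l)%N && (pilot_l + lmax < gridM)%N;
  guard_k_in_grid : (2 * kmax <= pilot_k)%N && (pilot_k + 2 * kmax < gridN)%N;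
  Nc_gt0 : (0 < Nc)%N
}.

Section Model.
Context (R : realType) (S : system R).
Local Notation U := (nusers S).
Local Notation Q := (npaths S).
Local Notation M := (gridM S).
Local Notation N := (gridN S).
Implicit Types (u : 'I_U) (q : 'I_Q) (p : int * int).

Definition MN : R := (M * N)%N%:R.

Definition in_grid p : bool :=
  (0 <= p.1 < M%:Z) && (0 <= p.2 < N%:Z).

Definition is_pilot p : bool := p == ((pilot_l S)%:Z, (pilot_k S)%:Z).

Definition is_guard p : bool :=
  [&& in_grid p, ~~ is_pilot p, `|p.1 - (pilot_l S)%:Z| <= (lmax S)%:Z
    & `|p.2 - (pilot_k S)%:Z| <= (2 * kmax S)%N%:Z].

Definition is_data p : bool := [&& in_grid p, ~~ is_pilot p & ~~ is_guard p].

(* s_{u,q}(l,k); modz is the nonnegative residue. *)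
Definition shift u q (l : 'I_M) (k : 'I_N) : int * int :=
  (((l%:Z - (delay u q)%:Z) %% M%:Z)%Z, ((k%:Z - doppler u q) %% N%:Z)%Z).

Definition uservar u : R := \sum_(q < Q) pathvar u q.

Section Powers.
(* pcr, pcd : the fixed pilot and common-data powers P_{c,r}, P_{c,d} *)
Variables pcr pcd : R.

Definition Pp : R := (MN * Pmax S - pcr - (Nc S)%:R * pcd) / MN.

Definition eff_noise u : R := Pp * uservar u + noise_var S.

Definition errvar u q : R :=
  eff_noise u * pathvar u q / (pcr * pathvar u q + eff_noise u).

Definition Terr u : R := \sum_(q < Q) errvar u q.

Definition kappa u : R := uservar u - Terr u.

Definition eta u : R := pcd * Terr u + uservar u * Pp + noise_var S.

Definition lambda u : R := kappa u / eta u.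

(* The argument of log2 is positive whenever 0 <= x <= Pp, in particular at
   every feasible point, so the value of ln off (0,+oo) is irrelevant. *)
Definition private_rate u (x : R) : R :=
  (Nc S)%:R / MN * log2 (eta u / (eta u - kappa u * x)).

Definition Pc p : R := if is_pilot p then pcr else if is_data p then pcd else 0.

Definition common_rate_user u : R :=
  MN^-1 * \sum_(l < M) \sum_(k < N)
    log2 (1 + pcd * (\sum_(q < Q | is_data (shift u q l k))
                        (pathvar u q - errvar u q))
              / (\sum_(q < Q) errvar u q * Pc (shift u q l k)
                 + uservar u * Pp + noise_var S)).

(* Minimum over all users: the set of users is nonempty, and the base value of
   the iterated minimum is the rate of user 0. *)
Definition Rc : R :=
  \big[Num.min/common_rate_user (Ordinal (nusers_gt0 S))]_(u < U)
    common_rate_user u.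

Definition phi u (c : R) : R := 2 `^ (- (MN * (Rth S - c) / (Nc S)%:R)).

Definition Ppmin u (c : R) : R := (1 - phi u c) / lambda u.

Definition objective (P C : 'I_U -> R) : R :=
  Rc + \sum_(u < U) private_rate u (P u).

Definition feasible (P C : 'I_U -> R) : Prop :=
  [/\ forall u, Rth S <= C u + private_rate u (P u),
      \sum_(u < U) C u = Rc,
      \sum_(u < U) P u = Pp,
      forall u, 0 <= C u
    & forall u, 0 <= P u].

Definition optimal (P C : 'I_U -> R) : Prop :=
  feasible P C /\
  forall P' C', feasible P' C' -> objective P' C' <= objective P C.

Section Allocation.
Variable s : {perm 'I_U}.

(* Ranks are 0-based: user u = s j has rank j = s^-1 u; with 1-based
   ranks the factor j below would read j - 1. *)
Definition Cstar u : R :=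
  Num.min (Rth S) (Num.max (Rc - ((s^-1)%g u)%:R * Rth S) 0).

Definition Pstar u : R :=
  if (((s^-1)%g u).+1 < U)%N then Ppmin u (Cstar u)
  else Pp - \sum_(j < U | (j.+1 < U)%N) Ppmin (s j) (Cstar (s j)).

End Allocation.
End Powers.
End Model.

(* Main.v *)
(* At a feasible point let c_u = R^th - (private rate of u); then c_u <= R^th,
   the positive parts of the c_u sum to at most R_c, and the power spent by u
   is (1 - phi(c_u)) / lambda_u, where phi is an increasing exponential, hence
   convex.  For a fixed total of the c_u, i.e. a fixed sum rate, the power is
   least when sum_u phi(c_u) / lambda_u is largest.  By convexity of phi and
   monotonicity of the weights 1 / lambda_u, replacing two entries (x, y), the
   first of larger weight, by (m, x + y - m) with m >= max(x, y) does not
   decrease this sum, so it is largest when the c_u are filled greedily by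
   rank, the last user taking whatever keeps the total fixed.
   Hence the greedy allocation attains the sum rate of any feasible point with
   at most the same power; giving the power left over to the last user can
   only raise its rate.  The same comparison shows that the greedy
   allocation is feasible. *)
Require Import Defs.
From mathcomp Require Import all_boot all_order all_algebra all_fingroup.
From mathcomp Require Import reals sequences exp.
From mathcomp Require Import ring lra.
Import Order.TTheory GRing.Theory Num.Theory.
Local Open Scope ring_scope.

(** * Greedy filling and weighted sums of an increasing convex function *)

Section Greedy.
Context (R : realFieldType) (L : R).
Hypothesis L_ge0 : 0 <= L.

Definition greedy (rho : R) (j : nat) : R :=
  Num.min L (Num.max (rho - j%:R * L) 0).

Lemma greedy0 rho : 0 <= rho -> greedy rho 0 = Num.min L rho.
Proof. by move=> rho_ge0; rewrite /greedy mul0r subr0 (max_idPl rho_ge0). Qed.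

(** What exceeds the first capacity [L] is poured into the remaining entries; this recursion
    underlies the inductions below. *)
Lemma greedyS rho j : greedy rho j.+1 = greedy (Num.max (rho - L) 0) j.
Proof.
have jL_ge0 : 0 <= j%:R * L by rewrite mulr_ge0.
rewrite /greedy -natr1 mulrDl mul1r; congr Num.min.
by case: (leP (rho - L) 0) => ?; do 2 case: leP => ?; lra.
Qed.

Lemma greedy_sum rho n : 0 <= rho ->
  \sum_(j < n) greedy rho j = Num.min (n%:R * L) rho.
Proof.
elim: n rho => [|n IHn] rho rho_ge0.
  by rewrite big_ord0 mul0r (min_idPl rho_ge0).
rewrite big_ord_recl greedy0 //.
rewrite (eq_bigr (fun j : 'I_n => greedy (Num.max (rho - L) 0) j)).
  have nL_ge0 : 0 <= n%:R * L by rewrite mulr_ge0.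
  rewrite IHn ?le_max ?lexx ?orbT // -natr1 mulrDl mul1r.
  by case: (leP (rho - L) 0) => ?; do 3 (try case: leP => ?); lra.
by move=> j _; exact: greedyS.
Qed.

Variable D : R -> R.
Hypothesis D_mono : {homo D : x y / x <= y}.
(** Convexity in exchange form: [(m, x + y - m)] has the same sum as [(x, y)] and is more spread
    out. *)
Hypothesis D_convex : forall x y m,
  x <= m -> y <= m -> D x + D y <= D m + D (x + y - m).

(** The last entry is the untruncated remainder of the prescribed total [T], so it may be
    negative. *)
Definition greedy_value (w : nat -> R) n rho T : R :=
  \sum_(j < n) w j * D (greedy rho j)
    + w n * D (T - \sum_(j < n) greedy rho j).

Lemma greedy_valueS w n rho T : 0 <= rho ->
  greedy_value w n.+1 rho T = w 0 * D (Num.min L rho)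
    + greedy_value (fun j => w j.+1) n (Num.max (rho - L) 0)
        (T - Num.min L rho).
Proof.
move=> rho_ge0; rewrite /greedy_value !big_ord_recl /= greedy0 //.
rewrite opprD !addrA; congr (_ + _ + _).
  by apply: eq_bigr => j _; rewrite greedyS.
by congr (_ * D (_ - _)); apply: eq_bigr => j _; exact: greedyS.
Qed.

(** Split [a] as [b + (a - b)]: convexity settles the common weight [b], monotonicity the excess on
    the first entry. *)
Lemma weighted_exchange a b x y m :
  0 <= b <= a -> x <= m -> y <= m ->
  a * D x + b * D y <= a * D m + b * D (x + y - m).
Proof.
move=> /andP[b_ge0 le_ba] le_xm le_ym.
have := ler_wpM2l b_ge0 (D_convex _ _ _ le_xm le_ym).
have : 0 <= (a - b) * (D m - D x) by rewrite mulr_ge0 ?subr_ge0 ?D_mono.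
by lra.
Qed.

(* In the inductive step the budget of the first entry is raised to
   [min L rho] at the expense of the second one, which drops to
   [c + min L sigma - min L rho]; the second entry is then processed in the
   same way. *)
Lemma greedy_value_cons w n c sigma rho tau :
  (forall j, 0 <= w j) -> (forall j, w j.+1 <= w j) ->
  c <= L -> 0 <= sigma -> Num.max c 0 + sigma <= rho ->
  tau <= sigma -> tau <= n.+1%:R * L ->
  w 0 * D c + greedy_value (fun j => w j.+1) n sigma tau
    <= greedy_value w n.+1 rho (c + tau).
Proof.
elim: n w c sigma rho tau => [|n IHn] w c sigma rho tau w_ge0 w_noninc
  le_cL sigma_ge0 le_rho le_tau le_tauL.
  have [c_rho sigma_rho] : c <= rho /\ sigma <= rho.
    by move: le_rho; case: (leP c 0) => ? ?; split; lra.
  rewrite greedy_valueS; last by lra.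
  rewrite /greedy_value !big_ord0 !add0r !subr0.
  apply: weighted_exchange; rewrite ?w_ge0 ?w_noninc // le_min.
    by rewrite le_cL.
  by move: le_tauL; rewrite mul1r => ->; apply: le_trans sigma_rho.
have [c_rho sigma_rho] : c <= rho /\ sigma <= rho.
  by move: le_rho; case: (leP c 0) => ? ?; split; lra.
have rho_ge0 : 0 <= rho by lra.
rewrite [leRHS]greedy_valueS // [in leLHS]greedy_valueS //.
set m := Num.min L rho; set m' := Num.min L sigma.
set c' := c + m' - m.
have le_cm : c <= m by rewrite le_min le_cL.
have le_m'm : m' <= m.
  by rewrite /m /m'; case: (leP L rho) => ?; case: (leP L sigma) => ?; lra.
have := IHn (fun j => w j.+1) c' (Num.max (sigma - L) 0)
  (Num.max (rho - L) 0) (tau - m').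
have -> : c' + (tau - m') = c + tau - m by rewrite /c'; ring.
have := weighted_exchange (w 0) (w 1) c m' m; rewrite -/c'.
rewrite w_ge0 w_noninc => /(_ isT le_cm le_m'm) exch.
suff: [/\ c' <= L, 0 <= Num.max (sigma - L) 0,
  Num.max c' 0 + Num.max (sigma - L) 0 <= Num.max (rho - L) 0,
  tau - m' <= Num.max (sigma - L) 0 & tau - m' <= n.+1%:R * L].
  move=> [h1 h2 h3 h4 h5].
  by move=> /(_ (fun=> w_ge0 _) (fun=> w_noninc _) h1 h2 h3 h4 h5); lra.
have nL_ge0 : 0 <= n.+1%:R * L by rewrite mulr_ge0.
move: le_tauL le_rho; rewrite -natr1 mulrDl mul1r /c' /m /m'.
case: (leP c 0) => ?; case: (leP L rho) => ?; case: (leP L sigma) => ?;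
  case: (leP (sigma - L) 0) => ?; case: (leP (rho - L) 0) => ? ? ?;
  by split; try (rewrite -lerBrDr ge_max; apply/andP; split); lra.
Qed.

Lemma greedy_value_max w n (C : nat -> R) rho :
  (forall j, 0 <= w j) -> (forall j, w j.+1 <= w j) ->
  (forall j, C j <= L) -> \sum_(j < n.+1) Num.max (C j) 0 <= rho ->
  \sum_(j < n.+1) w j * D (C j)
    <= greedy_value w n rho (\sum_(j < n.+1) C j).
Proof.
elim: n w C rho => [|n IHn] w C rho w_ge0 w_noninc C_le.
  by rewrite /greedy_value !big_ord1 !big_ord0 add0r subr0.
rewrite ![\sum_(_ < n.+2) _]big_ord_recl /= => le_rho.
(* The budget of the tail is exactly the sum of its own positive parts; [greedy_value_cons] then
   merges the head with it. *)
have IH := IHn (fun j => w j.+1) (fun j => C j.+1) _ (fun=> w_ge0 _)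
  (fun=> w_noninc _) (fun=> C_le _) (lexx _).
apply: le_trans (greedy_value_cons _ _ _ _ _ _ w_ge0 w_noninc (C_le 0) _
  le_rho _ _); first by rewrite lerD2l; exact: IH.
- by apply: sumr_ge0 => j _; rewrite le_max lexx orbT.
- by apply: ler_sum => j _; rewrite le_max lexx.
- by rewrite mulr_natl -[X in _ *+ X]card_ord -sumr_const; apply: ler_sum.
Qed.

Lemma greedy_ord_max U (w C : 'I_U -> R) rho (l : 'I_U) :
  l.+1 = U -> (forall j, 0 <= w j) ->
  (forall i j : 'I_U, (i <= j)%N -> w j <= w i) ->
  (forall j, C j <= L) -> \sum_j Num.max (C j) 0 <= rho ->
  \sum_j w j * D (C j)
    <= \sum_(j < U | (j.+1 < U)%N) w j * D (greedy rho j)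
       + w l * D (\sum_j C j - \sum_(j < U | (j.+1 < U)%N) greedy rho j).
Proof.
case: U w C l => [|n] w C l; first by case: l.
move=> [l_n] w_ge0 w_noninc C_le le_rho.
have lE : l = ord_max by exact: val_inj.
have sumE (F : nat -> R) : \sum_(j < n.+1 | (j.+1 < n.+1)%N) F j
    = \sum_(j < n) F j.
  rewrite big_mkcond big_ord_recr /= ltnn addr0.
  by apply: eq_bigr => j _; rewrite ltnS ltn_ord.
(* Clamping by [minn j n] keeps the weights nonincreasing on all of [nat]; [inord] alone would send
   indices above [n] back to 0. For [C] this default is harmless, since only the bound by [L] is
   required there. *)
have := greedy_value_max (fun j => w (inord (minn j n))) n
  (fun j => C (inord j)) rho.
rewrite /greedy_value.
rewrite -(sumE (fun j => w (inord (minn j n)) * D (greedy rho j))).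
rewrite -(sumE (greedy rho)) minnn.
have <- : l = inord n by rewrite lE; apply: val_inj; rewrite /= inordK.
have wE (j : 'I_n.+1) : w (inord (minn j n)) = w j.
  by rewrite (minn_idPl _) ?inord_val // -ltnS.
have -> : \sum_(j < n.+1) w (inord (minn j n)) * D (C (inord j))
    = \sum_j w j * D (C j).
  by apply: eq_bigr => j _; rewrite wE inord_val.
have -> : \sum_(j < n.+1 | (j.+1 < n.+1)%N)
    w (inord (minn j n)) * D (greedy rho j)
    = \sum_(j < n.+1 | (j.+1 < n.+1)%N) w j * D (greedy rho j).
  by apply: eq_bigr => j _; rewrite wE.
have -> : \sum_(j < n.+1) C (inord j) = \sum_j C j.
  by apply: eq_bigr => j _; rewrite inord_val.
apply => //.
- move=> j; apply: w_noninc; rewrite !inordK ?ltnS ?geq_minr //.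
  by rewrite leq_min geq_minr (leq_trans (geq_minl _ _)).
- by under eq_bigr do rewrite inord_val.
Qed.

End Greedy.
Arguments greedy {R}.

(** * Private rate and minimum power of a single user *)

Section PrivateRate.
Context (R : realType) (S : system R) (pcr pcd : R).
Hypotheses (pcr_ge0 : 0 <= pcr) (pcd_ge0 : 0 <= pcd).
Hypothesis Pp_ge0 : 0 <= Pp S pcr pcd.
Implicit Types (u v : 'I_(nusers S)) (c x : R).
Local Notation Pp := (Pp S pcr pcd).
Local Notation eta := (eta pcr pcd).
Local Notation kappa := (kappa pcr pcd).
Local Notation lambda := (lambda pcr pcd).
Local Notation private_rate := (private_rate pcr pcd).
Local Notation Ppmin := (Ppmin pcr pcd).

Lemma MN_gt0 : 0 < MN S.
Proof. by rewrite ltr0n muln_gt0 gridM_gt0 gridN_gt0. Qed.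

Lemma uservar_ge0 u : 0 <= uservar u.
Proof. by apply: sumr_ge0 => q _; exact: ltW (pathvar_gt0 _ _). Qed.

Lemma eff_noise_gt0 u : 0 < eff_noise pcr pcd u.
Proof.
rewrite ltr_wpDl ?noise_var_gt0 //.
by rewrite (mulr_ge0 Pp_ge0) ?uservar_ge0.
Qed.

Lemma errvar_ge0 u q : 0 <= errvar pcr pcd u q.
Proof.
have p_gt0 := pathvar_gt0 u q; have n_gt0 := eff_noise_gt0 u.
apply: divr_ge0; first by rewrite mulr_ge0 ?ltW.
by rewrite ltW // ltr_wpDl // mulr_ge0 // ltW.
Qed.

Lemma errvar_lt u q : 0 < pcr -> errvar pcr pcd u q < pathvar u q.
Proof.
move=> pcr_gt0; have p_gt0 := pathvar_gt0 u q; have n_gt0 := eff_noise_gt0 u.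
have pp_gt0 : 0 < pcr * pathvar u q by rewrite mulr_gt0.
rewrite /errvar ltr_pdivrMr; last exact: addr_gt0.
by rewrite mulrDr [ltLHS]mulrC ltrDr mulr_gt0.
Qed.

Lemma Terr_ge0 u : 0 <= Terr pcr pcd u.
Proof. by apply: sumr_ge0 => q _; exact: errvar_ge0. Qed.

Lemma kappa_gt0 u : 0 < pcr -> 0 < kappa u.
Proof.
move=> pcr_gt0; rewrite subr_gt0; apply: ltr_sum => [|q _].
  by apply/hasP; exists (Ordinal (npaths_gt0 S)); rewrite ?mem_index_enum.
exact: errvar_lt.
Qed.

Lemma eta_gt0 u : 0 < eta u.
Proof.
rewrite ltr_wpDl ?noise_var_gt0 // addr_ge0 //.
  by rewrite mulr_ge0 ?Terr_ge0.
by rewrite mulr_ge0 ?uservar_ge0.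
Qed.

Lemma lambda_gt0 u : 0 < pcr -> 0 < lambda u.
Proof. by move=> pcr_gt0; rewrite divr_gt0 ?kappa_gt0 ?eta_gt0. Qed.

(** The difference [eta u - kappa u * Pp] is [(pcd + Pp) * Terr] plus the noise variance, hence
    positive. *)
Lemma lambda_Pp_lt1 u : lambda u * Pp < 1.
Proof.
rewrite /Defs.lambda mulrAC ltr_pdivrMr ?eta_gt0 // mul1r /Defs.kappa /Defs.eta.
rewrite mulrBl -addrA.
have := noise_var_gt0 S.
have : 0 <= pcd * Terr pcr pcd u by rewrite mulr_ge0 ?Terr_ge0.
have : 0 <= Terr pcr pcd u * Pp by rewrite mulr_ge0 ?Terr_ge0.
by lra.
Qed.

(* Without pilot power the channel estimate carries no information. *)
Lemma private_rate_no_pilot u x : pcr = 0 -> private_rate u x = 0.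
Proof.
move=> pcr0; have -> : private_rate u x
    = (Nc S)%:R / MN S * log2 (eta u / (eta u - kappa u * x)) by [].
suff -> : kappa u = 0.
  by rewrite mul0r subr0 divff ?gt_eqF ?eta_gt0 // /log2 ln1 mul0r mulr0.
apply/eqP; rewrite subr_eq0; apply/eqP; apply: eq_bigr => q _.
rewrite /errvar {2}pcr0 mul0r add0r mulrAC divff ?mul1r //.
by rewrite gt_eqF ?eff_noise_gt0.
Qed.

Lemma ln2_gt0 : 0 < ln (2 : R).
Proof. by rewrite ln_gt0 // ltr1n. Qed.

(** Passing from base 2 to [expR] exposes a positive slope common to all users. *)
Lemma phiE u c :
  phi u c = expR (MN S * ln 2 / (Nc S)%:R * (c - Rth S)).
Proof.
rewrite /phi /powR pnatr_eq0 /=; congr expR.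
by field; rewrite pnatr_eq0 -lt0n Nc_gt0.
Qed.

Lemma phi_slope_gt0 : 0 < MN S * ln 2 / (Nc S)%:R.
Proof. by rewrite divr_gt0 ?mulr_gt0 ?MN_gt0 ?ln2_gt0 // ltr0n Nc_gt0. Qed.

Lemma ler_phi u c c' : (phi u c <= phi u c') = (c <= c').
Proof. by rewrite !phiE ler_expR ler_pM2l ?phi_slope_gt0 // lerD2r. Qed.

Lemma phi_Rth u : phi u (Rth S) = 1.
Proof. by rewrite phiE subrr mulr0 expR0. Qed.

(** The images under [phi] of the two pairs have the same product, so after multiplication by
    [phi u m] the difference of the sides is [(phi u m - phi u x) * (phi u m - phi u y)]. *)
Lemma phi_convex u x y m :
  x <= m -> y <= m -> phi u x + phi u y <= phi u m + phi u (x + y - m).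
Proof.
move=> le_xm le_ym.
have prodE : phi u m * phi u (x + y - m) = phi u x * phi u y.
  by rewrite !phiE -!expRD; congr expR; ring.
have m_gt0 : 0 < phi u m by rewrite phiE expR_gt0.
rewrite -(ler_pM2l m_gt0) !mulrDr prodE.
have : 0 <= (phi u m - phi u x) * (phi u m - phi u y).
  by rewrite mulr_ge0 // subr_ge0 ler_phi.
by lra.
Qed.

(** The private rate is [- Nc / MN] times [log2 (1 - lambda u * x)], which [phi] inverts; power thus
    becomes affine in [phi] of the rate still needed. *)
Lemma phi_private_rate u x :
  x <= Pp -> 0 < pcr -> phi u (Rth S - private_rate u x) = 1 - lambda u * x.
Proof.
move=> le_xPp pcr_gt0.
have eta0 := eta_gt0 u.
have lx_lt1 : 0 < 1 - lambda u * x.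
  rewrite subr_gt0; apply: le_lt_trans (lambda_Pp_lt1 u).
  by rewrite ler_pM2l ?lambda_gt0.
have lamE : lambda u = kappa u / eta u by [].
have etaE : eta u / (eta u - kappa u * x) = (1 - lambda u * x)^-1.
  have -> : eta u - kappa u * x = eta u * (1 - lambda u * x).
    by rewrite lamE; field; rewrite gt_eqF.
  by rewrite invfM mulrA divff ?gt_eqF // mul1r.
have -> : private_rate u x
    = (Nc S)%:R / MN S * log2 (eta u / (eta u - kappa u * x)) by [].
rewrite etaE phiE /log2 lnV ?posrE //.
rewrite -[RHS]lnK ?posrE //; congr expR; field.
by rewrite !gt_eqF ?ln2_gt0 ?ltr0n ?Nc_gt0 ?gridM_gt0 ?gridN_gt0.
Qed.

Lemma Ppmin_ge0 u c : 0 < pcr -> c <= Rth S -> 0 <= Ppmin u c.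
Proof.
move=> pcr_gt0 le_c; rewrite divr_ge0 ?(ltW (lambda_gt0 _ _)) //.
by rewrite subr_ge0 -(phi_Rth u) ler_phi.
Qed.

Lemma Ppmin_le_private_rate u c x :
  x <= Pp -> 0 < pcr -> (Ppmin u c <= x) = (Rth S - c <= private_rate u x).
Proof.
move=> le_xPp pcr_gt0; have lam_gt0 := lambda_gt0 u pcr_gt0.
rewrite [RHS]lerBlDr -[RHS]lerBlDl -[RHS](ler_phi u) phi_private_rate //.
by rewrite lerBlDr -lerBlDl mulrC -ler_pdivrMr.
Qed.

Lemma private_rate_Ppmin u c :
  Ppmin u c <= Pp -> 0 < pcr -> private_rate u (Ppmin u c) = Rth S - c.
Proof.
move=> le_Pp pcr_gt0; apply/eqP; rewrite eq_le -Ppmin_le_private_rate // lexx.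
rewrite andbT lerBrDl -lerBrDr -(ler_phi u) phi_private_rate //.
by rewrite mulrC divfK ?gt_eqF ?lambda_gt0 // opprB addrC subrK.
Qed.

(** * The starred allocation, sorted by rank *)

Section Allocation.
Variables (s : {perm 'I_(nusers S)}) (l : 'I_(nusers S)).
Hypotheses (pcr_gt0 : 0 < pcr) (l_last : l.+1 = nusers S).
Hypothesis Rc_ge0 : 0 <= Rc S pcr pcd.
Hypothesis Rc_lt : Rc S pcr pcd < (nusers S)%:R * Rth S.
Hypothesis lambda_sorted : forall i j : 'I_(nusers S), (i <= j)%N ->
  lambda (s i) <= lambda (s j).
Local Notation U := (nusers S).
Local Notation Rc := (Rc S pcr pcd).
Local Notation Cstar := (Cstar pcr pcd s).
Local Notation Pstar := (Pstar pcr pcd s).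

Let not_last (j : 'I_U) : (j.+1 < U)%N = (j != l).
Proof. by rewrite ltn_neqAle ltn_ord andbT -val_eqE -(eqSS j) l_last. Qed.

Lemma sum_ranked (F : 'I_U -> R) :
  \sum_u F u = \sum_(j < U | (j.+1 < U)%N) F (s j) + F (s l).
Proof.
rewrite (reindex_inj (@perm_inj _ s)) (bigD1 l) //= addrC.
by congr (_ + _); apply: eq_bigl => j; rewrite not_last.
Qed.

Lemma Cstar_greedy j : Cstar (s j) = greedy (Rth S) Rc j.
Proof. by rewrite /Defs.Cstar permK. Qed.

Lemma Cstar_sum : \sum_u Cstar u = Rc.
Proof.
rewrite (reindex_inj (@perm_inj _ s)) (eq_bigr _ (fun j _ => Cstar_greedy j)).
by rewrite greedy_sum ?Rth_ge0 // (min_idPr (ltW Rc_lt)).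
Qed.

Lemma Cstar_le u : Cstar u <= Rth S.
Proof. by rewrite ge_min lexx. Qed.

Lemma Cstar_ge0 u : 0 <= Cstar u.
Proof. by rewrite le_min Rth_ge0 le_max lexx orbT. Qed.

Lemma Pstar_ranked (j : 'I_U) : (j.+1 < U)%N ->
  Pstar (s j) = Ppmin (s j) (Cstar (s j)).
Proof. by rewrite /Defs.Pstar permK => ->. Qed.

Lemma Pstar_last : Pstar (s l)
  = Pp - \sum_(j < U | (j.+1 < U)%N) Ppmin (s j) (Cstar (s j)).
Proof. by rewrite /Defs.Pstar permK l_last ltnn. Qed.

Lemma Pstar_sum : \sum_u Pstar u = Pp.
Proof.
by rewrite sum_ranked Pstar_last (eq_bigr _ Pstar_ranked) addrC subrK.
Qed.

(** * Comparison with an arbitrary feasible point *)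

Section Feasible.
Variables P C : 'I_U -> R.
Hypothesis feasPC : feasible pcr pcd P C.

Lemma feasible_le_Pp u : P u <= Pp.
Proof.
have [_ _ <- _ P_ge0] := feasPC.
by rewrite (bigD1 u) //= lerDl sumr_ge0.
Qed.

(* Negative when the private rate alone exceeds the threshold. *)
Let need u := Rth S - private_rate u (P u).

Lemma need_le_Rth u : need u <= Rth S.
Proof.
have [_ _ _ _ P_ge0] := feasPC.
rewrite -(ler_phi u) phi_private_rate ?feasible_le_Pp // phi_Rth.
by rewrite gerBl mulr_ge0 // ltW // lambda_gt0.
Qed.

Lemma need_le u : Num.max (need u) 0 <= C u.
Proof.
have [le_R _ _ C_ge0 _] := feasPC.
by rewrite ge_max C_ge0 andbT lerBlDr.
Qed.

(** What the last user takes when the others get their greedy share and the total need of the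
    feasible point is kept. *)
Let slack := \sum_u need u - \sum_(j < U | (j.+1 < U)%N) Cstar (s j).

Lemma slack_le : slack <= Cstar (s l).
Proof.
have [_ sumC _ _ _] := feasPC.
rewrite lerBlDl -sum_ranked Cstar_sum -sumC; apply: ler_sum => u _.
by apply: le_trans (need_le u); rewrite le_max lexx.
Qed.

(** An instance of [greedy_ord_max] with the inverses of [lambda] as weights and [phi] as [D]: the
    larger weighted sum means less power, so greedy filling with [slack] for the last user costs at
    most [Pp]. *)
Lemma Ppmin_slack_le : Ppmin (s l) slack <= Pstar (s l).
Proof.
have [_ sumC sumP _ P_ge0] := feasPC.
have phi_homo : {homo phi (s l) : x y / x <= y} by move=> x y; rewrite ler_phi.
(* The value of [phi] is the same for every user, so [phi (s l)] can serve as the single function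
   [D]. *)
have needE u : (lambda u)^-1 * phi (s l) (need u) = (lambda u)^-1 - P u.
  have -> : phi (s l) (need u) = phi u (need u) by [].
  rewrite phi_private_rate ?feasible_le_Pp // mulrBr mulr1 mulKf //.
  by rewrite gt_eqF ?lambda_gt0.
have PpminE u c :
  Ppmin u c = (lambda u)^-1 - (lambda u)^-1 * phi (s l) c.
  by rewrite /Defs.Ppmin mulrC mulrBr mulr1.
have := @greedy_ord_max _ _ (Rth_ge0 S) _ phi_homo (phi_convex (s l))
  _ (fun j => (lambda (s j))^-1) (fun j => need (s j)) Rc l l_last.
have sum_s (F : 'I_U -> R) : \sum_j F (s j) = \sum_u F u.
  by rewrite [RHS](reindex_inj (@perm_inj _ s)).
rewrite (eq_bigr _ (fun j _ => needE (s j))).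
rewrite (sum_s (fun u => (lambda u)^-1 - P u)) sumrB sumP.
rewrite (sum_s need) (sum_s (fun u => Num.max (need u) 0)).
under [\sum_(j < U | _) greedy _ _ _]eq_bigr do rewrite -Cstar_greedy.
under [\sum_(j < U | _) (_ * _)]eq_bigr do rewrite -Cstar_greedy.
rewrite -/slack Pstar_last PpminE (sum_ranked (fun u => (lambda u)^-1)).
under [\sum_(_ < _ | _) Ppmin _ _]eq_bigr do rewrite PpminE.
rewrite sumrB => H.
have inv_ge0 (j : 'I_U) : 0 <= (lambda (s j))^-1.
  by rewrite invr_ge0 ltW ?lambda_gt0.
have inv_sorted (i j : 'I_U) :
    (i <= j)%N -> (lambda (s j))^-1 <= (lambda (s i))^-1.
  by move=> /lambda_sorted le_ij; rewrite lef_pV2 // posrE lambda_gt0.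
have sum_need : \sum_u Num.max (need u) 0 <= Rc.
  by rewrite -sumC; apply: ler_sum => u _; exact: need_le.
have := H inv_ge0 inv_sorted (fun j => need_le_Rth (s j)) sum_need.
by lra.
Qed.

Lemma Pstar_ge0 u : 0 <= Pstar u.
Proof.
rewrite -[u](permKV s); set j := (s^-1)%g u.
case: (boolP (j.+1 < U)%N) => [j_lt|].
  by rewrite Pstar_ranked // Ppmin_ge0 ?Cstar_le.
rewrite not_last negbK => /eqP ->.
apply: le_trans Ppmin_slack_le; rewrite Ppmin_ge0 //.
exact: le_trans slack_le (Cstar_le _).
Qed.

Lemma Pstar_le_Pp u : Pstar u <= Pp.
Proof.
rewrite -Pstar_sum (bigD1 u) //= lerDl sumr_ge0 // => v _; exact: Pstar_ge0.
Qed.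

Lemma private_rate_ranked (j : 'I_U) : (j.+1 < U)%N ->
  private_rate (s j) (Pstar (s j)) = Rth S - Cstar (s j).
Proof.
by move=> j_lt; rewrite Pstar_ranked // private_rate_Ppmin // -Pstar_ranked //
  Pstar_le_Pp.
Qed.

Lemma private_rate_last : Rth S - slack <= private_rate (s l) (Pstar (s l)).
Proof. by rewrite -Ppmin_le_private_rate ?Pstar_le_Pp ?Ppmin_slack_le. Qed.

Lemma star_feasible : feasible pcr pcd Pstar Cstar.
Proof.
split; [|exact: Cstar_sum|exact: Pstar_sum|exact: Cstar_ge0|exact: Pstar_ge0].
move=> u; rewrite -[u](permKV s); set j := (s^-1)%g u.
case: (boolP (j.+1 < U)%N) => [j_lt|].
  by rewrite private_rate_ranked // addrC subrK.
rewrite not_last negbK => /eqP ->.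
have := private_rate_last; have := slack_le; lra.
Qed.

(** The rates [Rth S - Cstar] of the other ranks and the bound [Rth S - slack] for the last add up
    exactly to the sum rate of [P], by the choice of [slack]. *)
Lemma objective_le_star :
  objective pcr pcd P C <= objective pcr pcd Pstar Cstar.
Proof.
rewrite lerD2l (sum_ranked (fun u => private_rate u (Pstar u))).
rewrite (eq_bigr _ private_rate_ranked).
apply: le_trans (lerD (lexx _) private_rate_last).
rewrite /slack /need !sumrB.
rewrite (sum_ranked (fun=> Rth S)).
by lra.
Qed.

End Feasible.
End Allocation.
End PrivateRate.

Theorem theorem2 (R : realType) (S : system R) (pcr pcd : R)
    (s : {perm 'I_(nusers S)}) :
  0 <= pcr -> 0 <= pcd -> 0 <= Pp S pcr pcd ->
  (exists P C : 'I_(nusers S) -> R, feasible pcr pcd P C) ->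
  0 <= Rc S pcr pcd -> Rc S pcr pcd < (nusers S)%:R * Rth S ->
  (forall i j : 'I_(nusers S), (i <= j)%N ->
     lambda pcr pcd (s i) <= lambda pcr pcd (s j)) ->
  optimal pcr pcd (Pstar pcr pcd s) (Cstar pcr pcd s).
Proof.
move=> pcr_ge0 pcd_ge0 Pp_ge0 [P0 [C0 feas0]] Rc_ge0 Rc_lt lambda_sorted.
have last_lt : ((nusers S).-1 < nusers S)%N by rewrite prednK ?nusers_gt0.
have l_last : (Ordinal last_lt).+1 = nusers S by rewrite /= prednK ?nusers_gt0.
(* Without pilot power all private rates vanish, so every user would need [Rth S] of common rate,
   contradicting [Rc_lt]. *)
have pcr_gt0 : 0 < pcr.
  rewrite lt_neqAle pcr_ge0 andbT; apply/negP => /eqP/esym pcr0.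
  have [rate_ge sumC _ _ _] := feas0.
  have : \sum_(u < nusers S) Rth S <= \sum_u C0 u.
    apply: ler_sum => u _; have := rate_ge u.
    by rewrite private_rate_no_pilot // addr0.
  by rewrite sumC sumr_const card_ord -mulr_natl leNgt Rc_lt.
split=> [|P C feas].
  by apply: star_feasible l_last _ _ _ _ _ feas0.
by apply: objective_le_star l_last _ _ _ _ _ feas.
Qed.
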